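(* For each integer $n\ge1$, $$g_T(T_{4,4n})\le 2n,\qquad g_T(T_{4,4n+2})\le 2n+1,\qquad g_T(T_{5,5n})\le 4n,\qquad g_T(T_{6,6n})\le 6n.$$
   Context: For positive integers $p,q$, $T_{p,q}\subset S^3$ is the (positive) $(p,q)$-torus link, i.e. the closure of the braid $(\sigma_1\sigma_2\cdots\sigma_{p-1})^q$ on $p$ strands. Turaev genus. Each crossing of a link diagram $D\subset S^2$ has two resolutions: the $A$-resolution is the smoothing that merges the two regions swept out when the overstrand is rotated counterclockwise until it meets the understrand, and the $B$-resolution is the other smoothing. Let $c(D)$ be the number of crossings of $D$, and let $s_A(D)$ (resp. $s_B(D)$) be the number of simple closed curves obtained by choosing the $A$-resolution (resp. $B$-resolution) at every crossing. For a connected diagram $D$ (connected as a 4-valent plane graph), the genus of the Turaev surface of $D$ is $$g_T(D)=\tfrac12\bigl(2+c(D)-s_A(D)-s_B(D)\bigr).$$ The torus links considered are non-split, so all of their diagrams are connected. The Turaev genus of such a link $L$ is $g_T(L)=\min\{g_T(D) : D \text{ is a diagram of } L\}$. *)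

(* Defs.v *)
From Stdlib Require Import Relations ClassicalEpsilon.
From mathcomp Require Import all_boot.

Set Implicit Arguments.
Unset Strict Implicit.
Unset Printing Implicit Defensive.

(* Unoriented link diagrams are presented in Morse position: a diagram is cut
   by horizontal lines into slices, each containing a single cup, cap or
   crossing, and is the word of these slices read from bottom to top.  The
   piece (k, i) is a slice in which the leftmost end of the event k is in
   position i, counted from 0 at the left; all other strands go straight up.
   Every diagram in the plane (or in S^2, after choosing a point at infinity)
   is isotopic in the plane to one of this form. *)

(* In Crossing true the overstrand runs from bottom left to top right, so that
   this is a positive crossing when both strands are oriented upwards; in
   Crossing false it runs from bottom right to top left. *)
Inductive event := Cup | Cap | Crossing of bool.

Definition piece : Type := event * nat.

Definition ins (k : event) : nat := if k is Cup then 0 else 2.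
Definition outs (k : event) : nat := if k is Cap then 0 else 2.

Definition width (n : nat) (w : seq piece) : nat :=
  foldl (fun m (p : piece) => m - ins p.1 + outs p.1) n w.

Fixpoint fits (n : nat) (w : seq piece) : bool :=
  if w is p :: w' then
    (p.2 + ins p.1 <= n) && fits (n - ins p.1 + outs p.1) w'
  else true.

Definition closed (w : seq piece) : bool := fits 0 w && (width 0 w == 0).

Record diagram := Diagram { word :> seq piece; wordP : closed word }.

(* Planar isotopies and Reidemeister moves between diagrams in Morse position:
   the defining relations of the category of unoriented tangles.  In
   move_exchange, e is to the left of f and d strands separate them. *)
Inductive move : seq piece -> seq piece -> Prop :=
| move_exchange (e f : event) (i d : nat) :
    move [:: (e, i); (f, i + outs e + d)] [:: (f, i + ins e + d); (e, i)]
| move_zigzag_l (i : nat) : move [:: (Cup, i); (Cap, i.+1)] [::]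
| move_zigzag_r (i : nat) : move [:: (Cup, i.+1); (Cap, i)] [::]
| move_turn_cap (b : bool) (i : nat) :
    move [:: (Crossing b, i.+1); (Cap, i)]
         [:: (Crossing (~~ b), i); (Cap, i.+1)]
| move_turn_cup (b : bool) (i : nat) :
    move [:: (Cup, i); (Crossing b, i.+1)]
         [:: (Cup, i.+1); (Crossing (~~ b), i)]
| move_R1_cap (b : bool) (i : nat) :
    move [:: (Crossing b, i); (Cap, i)] [:: (Cap, i)]
| move_R1_cup (b : bool) (i : nat) :
    move [:: (Cup, i); (Crossing b, i)] [:: (Cup, i)]
| move_R2 (b : bool) (i : nat) :
    move [:: (Crossing b, i); (Crossing (~~ b), i)] [::]
| move_R3 (b : bool) (i : nat) :
    move [:: (Crossing b, i); (Crossing b, i.+1); (Crossing b, i)]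
         [:: (Crossing b, i.+1); (Crossing b, i); (Crossing b, i.+1)].

Definition step (D E : diagram) : Prop :=
  exists u l r v : seq piece,
    [/\ move l r, word D = u ++ l ++ v & word E = u ++ r ++ v].

Definition isotopic : diagram -> diagram -> Prop :=
  clos_refl_sym_trans diagram step.

(* A link is identified with the set of its diagrams. *)
Definition link : Type := diagram -> Prop.

Definition link_of (D : diagram) : link := isotopic D.

(* The 4-valent plane graph underlying w, each crossing being a vertex.  It is
   recorded by the points where w meets the horizontal lines between its
   slices: the j-th point of line k is Tagged _ j with tag k.  A slice
   identifies all the ends of its event with one another, and the two ends of
   every other strand.  In (s, j) below, s is false for the line under the
   slice and true for the line above it. *)
Definition event_end (p : piece) (s : bool) (j : nat) : bool :=
  p.2 <= j < p.2 + (if s then outs p.1 else ins p.1).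

Definition strand (p : piece) (j j' : nat) : bool :=
  if j < p.2 then j' == j
  else (p.2 + ins p.1 <= j) && (j' == j - ins p.1 + outs p.1).

Definition joined (p : piece) (x y : bool * nat) : bool :=
  [|| event_end p x.1 x.2 && event_end p y.1 y.2,
      [&& ~~ x.1, y.1 & strand p x.2 y.2]
    | [&& ~~ y.1, x.1 & strand p y.2 x.2]].

Definition point (w : seq piece) : finType :=
  {k : 'I_(size w).+1 & 'I_(width 0 (take k w))}.

Definition adjacent (w : seq piece) : rel (point w) := fun x y =>
  [exists k : 'I_(size w), exists s : bool, exists t : bool,
    [&& tag x == k + s :> nat, tag y == k + t :> nat
      & joined (nth (Cup, 0) w k)
          (s, nat_of_ord (tagged x)) (t, nat_of_ord (tagged y))]].

Definition components (w : seq piece) : nat :=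
  n_comp (@adjacent w) [pred x : point w | true].

Definition connected (D : diagram) : bool := components D == 1.

(* Rotating the overstrand of Crossing true counterclockwise sweeps out the
   regions above and below the crossing; merging them leaves two vertical
   strands.  For Crossing false these are the regions to the left and right,
   and merging them leaves a cap below a cup.  The resolution is the
   A-resolution for a = true and the B-resolution for a = false. *)
Definition resolve (a : bool) (p : piece) : seq piece :=
  if p.1 is Crossing b then
    if a == b then [::] else [:: (Cap, p.2); (Cup, p.2)]
  else [:: p].

(* The resolved word has no crossing left, so its components are circles. *)
Definition state_circles (a : bool) (D : diagram) : nat :=
  components (flatten [seq resolve a p | p <- word D]).

Definition s_A : diagram -> nat := state_circles true.
Definition s_B : diagram -> nat := state_circles false.

Definition crossings (D : diagram) : nat :=
  count (fun p : piece => if p.1 is Crossing _ then true else false) D.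

(* For connected D this is the genus of a closed orientable surface, so that
   the subtraction is not truncated and the halved number is even. *)
Definition diagram_genus (D : diagram) : nat :=
  (2 + crossings D - (s_A D + s_B D))./2.

Definition is_least (P : nat -> Prop) (g : nat) : Prop :=
  P g /\ forall h : nat, P h -> g <= h.

(* The diagrams of L are restricted to the connected ones, for which
   diagram_genus is meaningful.  The value is unspecified if L has none. *)
Definition turaev_genus (L : link) : nat :=
  epsilon (inhabits 0)
    (is_least (fun g => exists D : diagram,
       [/\ L D, connected D & diagram_genus D = g])).

(* Strands 0, ..., p - 1 carry the braid w; strand k is closed up by the strand
   in position 2 p - 1 - k. *)
Definition closure_word (p : nat) (w : seq piece) : seq piece :=
  [seq (Cup, i) | i <- iota 0 p] ++ w ++ [seq (Cap, i) | i <- rev (iota 0 p)].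

(* The word of (sigma_1 ... sigma_(p-1))^q, with sigma_(i+1) in position i. *)
Definition torus_braid (p q : nat) : seq piece :=
  flatten (nseq q [seq (Crossing true, i) | i <- iota 0 p.-1]).

Lemma fits_cat n u v : fits n (u ++ v) = fits n u && fits (width n u) v.
Proof. by elim: u n => //= p u IHu n; rewrite IHu andbA. Qed.

Lemma width_cat n u v : width n (u ++ v) = width (width n u) v.
Proof. exact: foldl_cat. Qed.

Lemma cupsP m p : fits m.*2 [seq (Cup, i) | i <- iota m p]
  /\ width m.*2 [seq (Cup, i) | i <- iota m p] = (m + p).*2.
Proof.
elim: p m => [|p IHp] m /=; first by rewrite addn0.
have [IHf IHw] := IHp m.+1.
rewrite addn0 subn0 -addnn leq_addr /= addnn.
by rewrite (_ : m.*2 + 2 = m.+1.*2) ?IHf ?IHw ?addSnnS // doubleS addn2.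
Qed.

Lemma capsP p : fits p.*2 [seq (Cap, i) | i <- rev (iota 0 p)]
  /\ width p.*2 [seq (Cap, i) | i <- rev (iota 0 p)] = 0.
Proof.
elim: p => [//|p [IHf IHw]].
rewrite -{2 4}addn1 iotaD rev_cat /= add0n doubleS !subSS subn0 addn0 addn2.
by rewrite IHf IHw !ltnS -addnn leq_addr.
Qed.

Lemma torus_braidP p q : fits p.*2 (torus_braid p q)
  /\ width p.*2 (torus_braid p q) = p.*2.
Proof.
have row s : all (fun i => i.+2 <= p.*2) s ->
    fits p.*2 [seq (Crossing true, i) | i <- s]
    /\ width p.*2 [seq (Crossing true, i) | i <- s] = p.*2.
  elim: s => //= i s IHs /andP[lt_i /IHs[Hf Hw]].
  by rewrite addn2 subnK ?lt_i ?Hf ?Hw //; apply: leq_trans lt_i.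
have [|Hf Hw] := row (iota 0 p.-1).
  apply/allP => i; rewrite mem_iota add0n => /andP[_].
  by case: p {row} => //= p lt_i; rewrite doubleS !ltnS -addnn ltnW ?ltn_addr.
rewrite /torus_braid; elim: q => //= q [IHf IHw].
by rewrite fits_cat width_cat Hf Hw.
Qed.

Lemma closed_torus p q : closed (closure_word p (torus_braid p q)).
Proof.
have [Uf Uw] := cupsP 0 p; have [Tf Tw] := torus_braidP p q.
have [Cf Cw] := capsP p.
rewrite /closed /closure_word !fits_cat !width_cat.
by rewrite (_ : 0 = 0.*2) // Uf Uw add0n Tf Tw Cf Cw.
Qed.

Definition torus_diagram (p q : nat) : diagram := Diagram (closed_torus p q).

Definition torus_link (p q : nat) : link := link_of (torus_diagram p q).

(* Main.v *)
Require Import Defs.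
From Stdlib Require Import Relations ClassicalEpsilon FunctionalExtensionality.
From mathcomp Require Import all_boot zify.

(* T(p,q) is the closure of a positive braid, and braid relations alone turn it
   into the closure of another positive word w; the genus of that diagram is
   (2 + |w| - p - s_B)/2.  So s_B has to be large.  The all-B state is the
   closure of the product in the Temperley-Lieb algebra of the letters e_i,
   where e_i e_i = d e_i produces a circle, while e_i e_j e_i = e_i for adjacent
   i, j costs two letters without a circle.

   Grouping strands into ribbons of two makes the full twists of the ribbons
   free: they are powers of single letters, in which every letter but the first
   gives a circle.  The remaining factor of the full twist is a braid of
   ribbons, and a crossing X of two ribbons (four letters) gives two circles.
   - p = 4: the full twist is s_1^2 s_3^2 X^2.
   - p = 5: it is s_1^2 s_3^2 X E, where E is X followed by a turn of the fifth
     strand around both ribbons.  X and E commute, so the n-th power is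
     s_1^2n s_3^2n X^n E^n; with E written suitably its 12 letters give 6
     circles.
   - p = 6: it is s_1^2 s_3^2 s_5^2 V^3 with V a cyclic permutation of three
     ribbons, V = l r for words l, r such that r l can be rewritten as a word U
     of 8 letters giving 4 circles; V^3n = l U^(3n-1) r.

   Lower bounds for the number of circles come from labellings of the points of
   a diagram that are constant on components; an equation of the
   Temperley-Lieb algebra becomes a way to extend labellings. *)

Set Implicit Arguments.
Unset Strict Implicit.
Unset Printing Implicit Defensive.

(** [epsilon] meets its specification only if a least genus exists. Excluded middle makes the
    predicate boolean, and a nonempty boolean predicate on the naturals has a minimum. *)
Lemma turaev_genus_le (L : link) (D : diagram) (g : nat) :
  L D -> connected D -> diagram_genus D <= g -> turaev_genus L <= g.
Proof.
move=> LD cD leDg; rewrite /turaev_genus.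
set P := fun g => exists D, _.
have PD : P (diagram_genus D) by exists D.
pose b h : bool := if excluded_middle_informative (P h) then true else false.
have bP h : reflect (P h) (b h).
  by rewrite /b; case: excluded_middle_informative => ?; constructor.
have exb : exists h, b h by exists (diagram_genus D); apply/bP.
have [m /bP Pm min_m] := ex_minnP exb.
have /(epsilon_spec (inhabits 0)) [_ le_eps] : exists h, is_least P h.
  by exists m; split=> // h /bP /min_m.
exact: leq_trans (le_eps _ PD) leDg.
Qed.

(** * Counting the components of a diagram *)

(* The labels of the points on the lines below and above the piece p, in this
   order. *)
Definition labels_compatible (T : Type) (p : piece) (s t : nat -> T) : Prop :=
  forall x y : bool * nat, joined p x y ->
    (if x.1 then t else s) x.2 = (if y.1 then t else s) y.2.

Lemma adjacent_sym (w : seq piece) : symmetric (@adjacent w).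
Proof.
suff sub x y : adjacent x y -> @adjacent w y x.
  by move=> x y; apply/idP/idP; apply: sub.
move=> /existsP[k /existsP[s /existsP[t /and3P[xk yk j]]]].
apply/existsP; exists k; apply/existsP; exists t; apply/existsP; exists s.
rewrite xk yk /=; move: j; rewrite /joined /=.
by case: s t {xk yk} => [] []; rewrite /= ?andbF ?orbF // andbC.
Qed.

Lemma connect_adjacent_sym (w : seq piece) : connect_sym (@adjacent w).
Proof. exact/sym_connect_sym/adjacent_sym. Qed.

(** The labelling descends to components, so each label of [L] is taken at some root, and distinct
    labels at distinct roots. *)
Lemma components_ge (w : seq piece) (S : nat -> nat -> nat) (L : seq nat) :
    (forall k, k < size w ->
       labels_compatible (nth (Cup, 0) w k) (S k) (S k.+1)) ->
    uniq L ->
    (forall a, a \in L -> exists k j,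
       [/\ k <= size w, j < width 0 (take k w) & S k j = a]) ->
  size L <= components w.
Proof.
move=> Sw uL surj.
pose f (x : point w) := S (tag x) (tagged x).
have fadj x y : adjacent x y -> f x = f y.
  move=> /existsP[k /existsP[s /existsP[t /and3P[/eqP xk /eqP yk j]]]].
  have shift (b : bool) i : S (k + b) i = (if b then S k.+1 else S k) i.
    by case: b; rewrite ?addn1 ?addn0.
  rewrite /f; move: (nat_of_ord (tagged x)) (nat_of_ord (tagged y)) j => i i'.
  by rewrite xk yk !shift => /(Sw k (ltn_ord k)).
have fcon x y : connect (@adjacent w) x y -> f x = f y.
  move=> /connectP[q + ->]; elim: q x => //= z q IHq x /andP[/fadj-> ?].
  exact: IHq.
have froot x : f (root (@adjacent w) x) = f x.
  by apply/esym/fcon/connect_root.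
have ex a : a \in L -> exists x, (x \in roots (@adjacent w)) && (f x == a).
  move=> /surj[k [j [lek ltj <-]]].
  pose k' : 'I_(size w).+1 := Ordinal (lek : k < (size w).+1).
  pose x : point w := existT (fun k : 'I_(size w).+1 => 'I_(width 0 (take k w)))
    k' (Ordinal (ltj : j < width 0 (take k' w))).
  exists (root (@adjacent w) x).
  rewrite froot /f /= eqxx andbT.
  by apply: roots_root; apply: connect_adjacent_sym.
have sub : {subset L <= [seq f x | x <- enum (roots (@adjacent w))]}.
  move=> a /ex[x /andP[rx /eqP <-]]; apply: map_f.
  by rewrite mem_enum.
apply: leq_trans (uniq_leq_size uL sub) _; rewrite size_map -cardE.
by apply/eq_leq/eq_card => x; rewrite !inE andbT.
Qed.

(** Connectedness as the constancy of all locally constant Boolean functions. Functions of two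
    naturals keep the dependent type [point] out of the applications. *)
Lemma components_eq1 (w : seq piece) (k0 j0 : nat) :
    k0 <= size w -> j0 < width 0 (take k0 w) ->
    (forall g : nat -> nat -> bool,
       (forall k s t j j', k < size w ->
          j < width 0 (take (k + nat_of_bool s) w) ->
          j' < width 0 (take (k + nat_of_bool t) w) ->
          joined (nth (Cup, 0) w k) (s, j) (t, j') ->
          g (k + s) j = g (k + t) j') ->
       forall k j, k <= size w -> j < width 0 (take k w) -> g k j = g k0 j0) ->
  components w = 1.
Proof.
move=> lek0 ltj0 gconst.
pose pt k j (lek : k < (size w).+1) (ltj : j < width 0 (take k w)) : point w :=
  existT (fun k : 'I_(size w).+1 => 'I_(width 0 (take k w)))
    (Ordinal lek) (Ordinal (ltj : j < width 0 (take (Ordinal lek) w))).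
pose x0 := pt k0 j0 lek0 ltj0.
(* The indicator of the component of [x0], false at pairs that are not points. *)
pose g k j := [exists x : point w,
  [&& tag x == k :> nat, tagged x == j :> nat & connect (@adjacent w) x0 x]].
have gpt k j lek ltj : g k j = connect (@adjacent w) x0 (pt k j lek ltj).
  apply/existsP/idP.
    move=> [[[k' ltk'] [j' ltj']] /and3P[/= /eqP kk' /eqP jj']].
    suff -> : existT _ (Ordinal ltk') (Ordinal ltj') = pt k j lek ltj by [].
    subst k' j'; rewrite /pt; rewrite (bool_irrelevance ltk' lek).
    rewrite (bool_irrelevance lek ltk') in ltj' *.
    by congr existT; apply: val_inj.
  by move=> con; exists (pt k j lek ltj); rewrite !eqxx.
have all1 (x : point w) : connect (@adjacent w) x0 x.
  case: x => [[k ltk] [j ltj]].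
  rewrite -[existT _ _ _]/(pt k j ltk ltj) -gpt.
  rewrite (gconst g) //; first by rewrite (gpt k0 j0 lek0 ltj0) connect0.
  move=> k1 s t j1 j2 ltk1 ltj1 ltj2 jn.
  have le1 (b : bool) : k1 + b < (size w).+1.
    by case: b; rewrite ?addn0 ?addn1 ltnS // ltnW.
  rewrite (gpt _ _ (le1 s) ltj1) (gpt _ _ (le1 t) ltj2).
  apply/(same_connect_r (@connect_adjacent_sym w))/connect1.
  apply/existsP; exists (Ordinal ltk1); apply/existsP; exists s.
  by apply/existsP; exists t; rewrite /= !eqxx.
rewrite -(n_comp_connect (@connect_adjacent_sym w) x0) /components.
by apply: eq_n_comp_r => x; rewrite !inE all1.
Qed.

(** * Labellings built up slice by slice *)

Definition insert_pair (i a : nat) (s : nat -> nat) : nat -> nat := fun j =>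
  if j < i then s j else if j < i.+2 then a else s (j - 2).

Definition delete_pair (i : nat) (s : nat -> nat) : nat -> nat := fun j =>
  if j < i then s j else s (j + 2).

(* A state labels all of nat; only the labels left of the width matter. L lists
   the labels chosen at the cups of w. *)
Fixpoint labelled (w : seq piece) (L : seq nat) (s t : nat -> nat) : Prop :=
  match w, L with
  | [::], [::] => s = t
  | (Cup, i) :: w', a :: L' => labelled w' L' (insert_pair i a s) t
  | (Cap, i) :: w', _ => s i = s i.+1 /\ labelled w' L (delete_pair i s) t
  | _, _ => False
  end.

Lemma labelled_cat u v L M s r t :
  labelled u L s r -> labelled v M r t -> labelled (u ++ v) (L ++ M) s t.
Proof.
elim: u L s => [|[[||b] i] u IHu] [|a L] s //=.
- by move=> ->.
- exact: IHu.
- by move=> [si ?] ?; split=> //; apply: (IHu [::]).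
- by move=> [si ?] ?; split=> //; apply: (IHu (a :: L)).
Qed.

Lemma compatible_intro (p : piece) (s t : nat -> nat) (a : nat) :
    (forall j, event_end p false j -> s j = a) ->
    (forall j, event_end p true j -> t j = a) ->
    (forall j j', strand p j j' -> s j = t j') ->
  labels_compatible p s t.
Proof.
move=> sa ta st [b x] [c y] /or3P[|/and3P[]|/and3P[]] /=.
- have end_a d z : event_end p d z -> (if d then t else s) z = a.
    by case: d; [apply: ta|apply: sa].
  by move=> /andP[/end_a-> /end_a->].
- by case: b c => [] [] // _ _ /st.
- by case: b c => [] [] // _ _ /st.
Qed.

Lemma insert_pair_compatible i a s :
  labels_compatible (Cup, i) s (insert_pair i a s).
Proof.
apply: (@compatible_intro _ _ _ a) => j;
  rewrite /event_end /strand /= ?addn0 ?subn0.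
- by lia.
- rewrite /insert_pair addn2 => /andP[? ->].
  by rewrite ltnNge; case: ltnP => //; lia.
- move=> j'; rewrite /insert_pair.
  case: ltnP => [ltj /eqP->|lej /andP[_ /eqP->]].
    by rewrite ltj.
  by rewrite !ifN ?addnK // -leqNgt; lia.
Qed.

Lemma delete_pair_compatible i s :
  s i = s i.+1 -> labels_compatible (Cap, i) s (delete_pair i s).
Proof.
move=> si; apply: (@compatible_intro _ _ _ (s i)) => j;
  rewrite /event_end /strand /= ?addn0.
- by move=> ?; have [->|->] : j = i \/ j = i.+1 by lia.
- by lia.
- move=> j'; rewrite /delete_pair.
  case: ltnP => [ltj /eqP->|lej /andP[ltj /eqP->]].
    by rewrite ltj.
  by rewrite ifN ?subnK // -?leqNgt; lia.
Qed.

(** [S k] is the state reached after [k] slices; the label chosen at a cup is read off on the line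
    just above it. *)
Lemma labelled_components n w L s t : fits n w -> labelled w L s t ->
  exists S : nat -> nat -> nat,
    [/\ S 0 = s,
        forall k, k < size w ->
          labels_compatible (nth (Cup, 0) w k) (S k) (S k.+1)
      & forall a, a \in L -> exists k j,
          [/\ k <= size w, j < width n (take k w) & S k j = a]].
Proof.
elim: w n L s => [|[[||b] i] w IHw] n [|a L] s //=.
- by exists (fun=> s).
- move=> /andP[lei fw] /(IHw _ _ _ fw)[S [S0 Sw SL]].
  exists (fun k => if k is k'.+1 then S k' else s); split=> // [[|k] ltk|c].
  + by rewrite S0; apply: insert_pair_compatible.
  + exact: Sw.
  + rewrite inE => /orP[/eqP->|/SL[k [j [lek ltj Skj]]]].
      exists 1, i; split=> //.
        by rewrite /= take0 /= subn0 addn2 ltnS ltnW // ltnS -[i]addn0.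
      by rewrite S0 /insert_pair ltnn ltnW.
    by exists k.+1, j.
- move=> /andP[lei fw] [si /(IHw _ _ _ fw)[S [S0 Sw SL]]].
  exists (fun k => if k is k'.+1 then S k' else s); split=> // [[|k] ltk].
  + by rewrite S0; apply: delete_pair_compatible.
  + exact: Sw.
- move=> /andP[lei fw] [si /(IHw _ _ _ fw)[S [S0 Sw SL]]].
  exists (fun k => if k is k'.+1 then S k' else s); split=> // [[|k] ltk|c].
  + by rewrite S0; apply: delete_pair_compatible.
  + exact: Sw.
  + by move=> /SL[k [j [lek ltj Skj]]]; exists k.+1, j.
Qed.

Lemma labelled_components_ge w L s t (M : seq nat) :
    fits 0 w -> labelled w L s t -> uniq M -> {subset M <= L} ->
  size M <= components w.
Proof.
move=> fw /(labelled_components fw)[S [_ Sw SL]] uM subML.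
by apply: components_ge Sw uM _ => a /subML /SL.
Qed.

(** * Temperley-Lieb words and their reductions *)

Definition tl_word (w : seq nat) : seq piece :=
  flatten [seq [:: (Cap, i); (Cup, i)] | i <- w].

Definition set_pair (i a : nat) (s : nat -> nat) : nat -> nat := fun j =>
  if i <= j <= i.+1 then a else s j.

Fixpoint tl_labelled (w L : seq nat) (s t : nat -> nat) : Prop :=
  match w, L with
  | [::], [::] => s = t
  | i :: w', a :: L' => s i = s i.+1 /\ tl_labelled w' L' (set_pair i a s) t
  | _, _ => False
  end.

Lemma insert_delete_pair i a s :
  insert_pair i a (delete_pair i s) = set_pair i a s.
Proof.
apply: functional_extensionality => j.
rewrite /insert_pair /delete_pair /set_pair.
have [ltj|[/andP[lej ltj]|ltj]] : j < i \/ i <= j <= i.+1 \/ i.+1 < j by lia.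
- by rewrite ltj ifN //; lia.
- by rewrite lej ltj ifN ?ifT //; lia.
- by rewrite !ifN ?subnK //; lia.
Qed.

Lemma tl_wordP w L s t : tl_labelled w L s t -> labelled (tl_word w) L s t.
Proof.
elim: w L s => [|i w IHw] [|a L] s //= [si /IHw].
by rewrite insert_delete_pair.
Qed.

Lemma tl_labelled_cat u v L M s r t :
  tl_labelled u L s r -> tl_labelled v M r t ->
  tl_labelled (u ++ v) (L ++ M) s t.
Proof.
elim: u L s => [|i u IHu] [|a L] s //=; first by move=> ->.
by move=> [si ?] ?; split=> //; apply: IHu.
Qed.

Lemma tl_labelled_split u v L s t : tl_labelled (u ++ v) L s t ->
  exists L1 L2 r,
    [/\ L = L1 ++ L2, tl_labelled u L1 s r & tl_labelled v L2 r t].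
Proof.
elim: u L s => [|i u IHu] L s /=; first by exists [::], L, s.
case: L => // a L [si /IHu[L1 [L2 [r [-> ? ?]]]]].
by exists (a :: L1), L2, r.
Qed.

(* In the Temperley-Lieb algebra with loop value d, u = d ^ k * v entails
   tl_reduces k u v. *)
Definition tl_reduces (k : nat) (u v : seq nat) : Prop :=
  forall F : seq nat, size F = k -> forall L s t, tl_labelled v L s t ->
    exists2 L', tl_labelled u L' s t & {subset F ++ L <= L'}.

Lemma tl_reduces_refl u : tl_reduces 0 u u.
Proof. by move=> F /size0nil-> L s t vL; exists L. Qed.

Lemma tl_reduces_trans k l u v w :
  tl_reduces k u v -> tl_reduces l v w -> tl_reduces (k + l) u w.
Proof.
move=> uv vw F szF L s t /(vw (drop k F))[|L' vL' sub'].
  by rewrite size_drop szF addKn.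
have [|L'' uL'' sub''] := uv (take k F) _ _ _ _ vL'.
  by rewrite size_take szF; case: ltnP => //; lia.
exists L'' => // a; rewrite -{1}(cat_take_drop k F) -catA mem_cat.
by move=> /orP[aF|/sub' aL]; apply: sub''; rewrite mem_cat ?aF ?aL ?orbT.
Qed.

Lemma tl_reduces_cat k l u v u' v' :
  tl_reduces k u u' -> tl_reduces l v v' ->
  tl_reduces (k + l) (u ++ v) (u' ++ v').
Proof.
move=> uu' vv' F szF L s t /tl_labelled_split[L1 [L2 [r [-> uL1 vL2]]]].
have [|M1 uM1 sub1] := uu' (take k F) _ _ _ _ uL1.
  by rewrite size_take szF; case: ltnP => //; lia.
have [|M2 vM2 sub2] := vv' (drop k F) _ _ _ _ vL2.
  by rewrite size_drop szF addKn.
exists (M1 ++ M2); first exact: tl_labelled_cat uM1 vM2.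
move=> a; rewrite -{1}(cat_take_drop k F) !mem_cat.
have := sub1 a; have := sub2 a; rewrite !mem_cat => s2 s1.
move=> /orP[] /orP[] h; apply/orP.
- by left; apply: s1; rewrite h.
- by right; apply: s2; rewrite h.
- by left; apply: s1; rewrite h orbT.
- by right; apply: s2; rewrite h orbT.
Qed.

Lemma tl_reduces_ctx k p u v q :
  tl_reduces k u v -> tl_reduces k (p ++ u ++ q) (p ++ v ++ q).
Proof.
move=> uv; rewrite -[k]add0n -[k in _ + k]addn0.
apply: tl_reduces_cat; first exact: tl_reduces_refl.
by apply: tl_reduces_cat => //; apply: tl_reduces_refl.
Qed.

Lemma set_pairE i a s j :
  set_pair i a s j = if (j == i) || (j == i.+1) then a else s j.
Proof. by rewrite /set_pair; congr (if _ then _ else _); lia. Qed.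

Lemma tl_labelled_cons i w L s t : tl_labelled (i :: w) L s t ->
  exists a L',
    [/\ L = a :: L', s i = s i.+1 & tl_labelled w L' (set_pair i a s) t].
Proof. by case: L => //= a L [? ?]; exists a, L. Qed.

Lemma tl_labelled_nil L s t : tl_labelled [::] L s t -> L = [::] /\ s = t.
Proof. by case: L. Qed.

Lemma tl_square i : tl_reduces 1 [:: i; i] [:: i].
Proof.
move=> [|f [|f' F]] // szF L s t /tl_labelled_cons[a [L1 [-> si]]].
move=> /tl_labelled_nil[-> <-].
(* The cup of the first letter and the cap of the second close up to a circle, whose label [f] is
   free. *)
exists [:: f; a] => //; split=> //; split=> /=.
  by rewrite !set_pairE !eqxx orbT.
by apply: functional_extensionality => j; rewrite !set_pairE; case: (_ || _).
Qed.

Lemma tl_jones i j : i.+1 = j \/ j.+1 = i -> tl_reduces 0 [:: i; j; i] [:: i].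
Proof.
move=> ij F /size0nil-> L s t /tl_labelled_cons[a [L1 [-> si]]].
move=> /tl_labelled_nil[-> <-].
(* The strand met by [j] but not by [i] runs through both inserted arcs, so its label is forced on
   the cups of the first [i] and of [j]. *)
pose b := s (if i < j then i.+2 else j).
exists [:: b; b; a]; last by move=> c; rewrite !inE => ->; rewrite !orbT.
have set3 x : set_pair i a (set_pair j b (set_pair i b s)) x = set_pair i a s x.
  rewrite !set_pairE; case: (boolP ((x == i) || _)) => // /norP[xi xi1].
  case: (boolP ((x == j) || _)) => // xj; congr s.
  by case: ltnP => ?; lia.
split=> //=; do !split=> //; last exact: functional_extensionality.
- rewrite !set_pairE /b.
  have -> : (j == i) || (j == i.+1) = (i < j) by lia.
  have -> : (j.+1 == i) || (j.+1 == i.+1) = ~~ (i < j) by lia.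
  by case: ltnP => //= ?; congr s; lia.
- rewrite !set_pairE eqxx.
  have -> : (i == j) || (i == j.+1) = ~~ (i < j) by lia.
  have -> : (i.+1 == j) || (i.+1 == j.+1) = (i < j) by lia.
  by rewrite eqxx orbT; case: ltnP.
Qed.

Lemma tl_far i j : i.+1 < j \/ j.+1 < i -> tl_reduces 0 [:: i; j] [:: j; i].
Proof.
move=> ij F /size0nil-> L s t /tl_labelled_cons[a [L1 [-> sj]]].
move=> /tl_labelled_cons[b [L2 [-> si]]] /tl_labelled_nil[-> <-].
exists [:: b; a]; last by move=> c; rewrite !inE orbC.
have [Eij Eji] : ((i == j) || (i == j.+1) = false)
    /\ ((i.+1 == j) || (i.+1 == j.+1) = false) by lia.
have [Fij Fji] : ((j == i) || (j == i.+1) = false)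
    /\ ((j.+1 == i) || (j.+1 == i.+1) = false) by lia.
move: si; rewrite /= !set_pairE Eij Eji Fij Fji => si; do !split=> //=.
apply: functional_extensionality => x; rewrite !set_pairE.
case: (boolP ((x == i) || _)) => // Ei.
by case: (boolP ((x == j) || _)) => // Ej; lia.
Qed.

(* One step of the reduction of w at position m, with the number of circles it
   removes. *)
Definition tl_move (m : nat) (w : seq nat) : nat * seq nat :=
  match drop m w with
  | [:: i, j & r] =>
      if i == j then (1, take m w ++ i :: r)
      else if (i.+1 < j) || (j.+1 < i) then (0, take m w ++ [:: j, i & r])
      else if r is k :: r' then
        if k == i then (0, take m w ++ i :: r') else (0, w)
      else (0, w)
  | _ => (0, w)
  end.

Fixpoint tl_moves (ms : seq nat) (w : seq nat) : nat * seq nat :=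
  if ms is m :: ms' then
    let: (k, u) := tl_move m w in let: (l, v) := tl_moves ms' u in (k + l, v)
  else (0, w).

Lemma tl_moveP m w : tl_reduces (tl_move m w).1 w (tl_move m w).2.
Proof.
rewrite /tl_move; have := cat_take_drop m w; move: (take m w) => q.
case: (drop m w) => [|i [|j r]] Ew; try exact: tl_reduces_refl.
case: eqP => [ij|/eqP ij].
  rewrite -Ew -ij.
  exact: (@tl_reduces_ctx _ q _ _ r (@tl_square i)).
case: ifP => [/orP far|/negbT/norP[]].
  by rewrite -Ew; apply: (@tl_reduces_ctx _ q _ _ r (@tl_far _ _ far)).
rewrite -!leqNgt => ji1 ij1.
case: r Ew => [|k r] Ew; first exact: tl_reduces_refl.
case: eqP => [ki|_]; last exact: tl_reduces_refl.
rewrite -Ew ki.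
by apply: (@tl_reduces_ctx _ q _ _ r (@tl_jones _ _ _)); lia.
Qed.

Lemma tl_movesP ms w : tl_reduces (tl_moves ms w).1 w (tl_moves ms w).2.
Proof.
elim: ms w => [|m ms IHms] w /=; first exact: tl_reduces_refl.
have := @tl_moveP m w; case: (tl_move m w) => k u /= wu.
have := @IHms u; case: (tl_moves ms u) => l v /= uv.
exact: tl_reduces_trans wu uv.
Qed.

(** * Powers of words *)

Definition power (u : seq nat) (n : nat) : seq nat := flatten (nseq n u).

Lemma powerS u n : power u n.+1 = u ++ power u n.
Proof. by []. Qed.

Lemma powerD u m n : power u (m + n) = power u m ++ power u n.
Proof. by rewrite /power nseqD flatten_cat. Qed.

Lemma powerM u m n : power u (m * n) = power (power u m) n.
Proof. by elim: n => [|n IHn]; rewrite ?muln0 // mulnS powerD IHn. Qed.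

(** Passes to powers of the rotated word [v ++ u], which can then be rewritten by braid relations
    that do not apply inside [u ++ v]. *)
Lemma power_rotate u v n :
  power (u ++ v) n.+1 = u ++ power (v ++ u) n ++ v.
Proof.
elim: n => [|n IHn]; first by rewrite /power /= cats0.
by rewrite powerS IHn powerS !catA.
Qed.

Lemma size_power u n : size (power u n) = n * size u.
Proof. by rewrite size_flatten /shape map_nseq sumn_nseq mulnC. Qed.

Lemma all_power (a : pred nat) u n : all a u -> all a (power u n).
Proof. by move=> au; elim: n => // n IHn; rewrite all_cat au. Qed.

(** [z] absorbs the copies of [u] one at a time and survives each time, so the circles add up. *)
Lemma tl_reduces_power k z u n :
  tl_reduces k (z ++ u) z -> tl_reduces (n * k) (z ++ power u n) z.
Proof.
move=> zu; elim: n => [|n IHn]; first by rewrite cats0; apply: tl_reduces_refl.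
rewrite powerS catA mulSn; apply: tl_reduces_trans IHn.
rewrite -[k]addn0; apply: tl_reduces_cat zu _; exact: tl_reduces_refl.
Qed.

Lemma tl_reduces_letter i n : tl_reduces n (power [:: i] n.+1) [:: i].
Proof.
rewrite -[n in tl_reduces n]muln1; apply: (@tl_reduces_power 1 [:: i]).
exact: tl_square.
Qed.

(** * Closures of words *)

Lemma closure_labelled p w L (s : nat -> nat) :
    (forall j, j < p -> s (p.*2.-1 - j) = s j) -> labelled w L s s ->
  exists t, labelled (closure_word p w) ([seq s j | j <- iota 0 p] ++ L) t t.
Proof.
move=> sym_s wL.
(* The state after the first [k] cups: the remaining [p - k] cups open in the middle and shift the
   points from [k] on by twice their number. The caps run through the same states backwards. *)
pose t k := fun j => if j < k then s j else s (j + (p - k).*2).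
have tp : t p = s.
  by apply: functional_extensionality => j; rewrite /t subnn addn0; case: ifP.
have t_ins k : k < p -> insert_pair k (s k) (t k) = t k.+1.
  move=> ltk; apply: functional_extensionality => j; rewrite /insert_pair /t.
  have [?|[->|[->|?]]] : j < k \/ j = k \/ j = k.+1 \/ k.+1 < j by lia.
  - by rewrite !ifT //; lia.
  - have [-> -> ->] : [/\ k < k = false, k < k.+2 & k < k.+1] by split; lia.
    by [].
  - have [-> -> ->] : [/\ k.+1 < k = false, k.+1 < k.+2 & k.+1 < k.+1 = false].
      by split; lia.
    by rewrite -sym_s //; congr s; lia.
  - by rewrite !ifN -?leqNgt //; try (by congr s; lia); lia.
have t_del k : k < p -> delete_pair k (t k.+1) = t k.
  move=> ltk; rewrite -t_ins //; apply: functional_extensionality => j.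
  rewrite /delete_pair /insert_pair; case: ltnP => // lekj.
  by rewrite !ifN ?addnK // -?leqNgt; lia.
have t_eq k : k < p -> t k.+1 k = t k.+1 k.+1.
  move=> ltk; rewrite -t_ins // /insert_pair.
  have [-> -> ->] : [/\ k < k = false, k < k.+2 & k.+1 < k = false].
    by split; lia.
  by rewrite ltnSn.
have cups m k : k + m = p ->
    labelled [seq (Cup, i) | i <- iota k m] [seq s i | i <- iota k m] (t k) s.
  elim: m k => [|m IHm] k /=; first by rewrite addn0 => ->.
  by move=> km; rewrite t_ins; [apply: IHm|]; lia.
have caps k : k <= p ->
    labelled [seq (Cap, i) | i <- rev (iota 0 k)] [::] (t k) (t 0).
  elim: k => [|k IHk] // ltk.
  rewrite -addn1 iotaD rev_cat /= add0n addn1; split; first exact: t_eq.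
  by rewrite t_del //; apply/IHk/ltnW.
exists (t 0); rewrite /closure_word.
apply: labelled_cat (cups p 0 _) _ => //; rewrite -[L]cats0.
by apply: labelled_cat wL _; rewrite -{1}tp; apply: caps.
Qed.

Definition braid_word (w : seq nat) : seq piece :=
  [seq (Crossing true, i) | i <- w].

Definition on_strands (p : nat) (w : seq nat) : bool :=
  all (fun i => i.+1 < p) w.

Lemma closed_closure p w :
  fits p.*2 w -> width p.*2 w = p.*2 -> Defs.closed (closure_word p w).
Proof.
move=> fw ww; have [Uf Uw] := cupsP 0 p; have [Cf Cw] := capsP p.
rewrite /Defs.closed /closure_word !fits_cat !width_cat.
by rewrite (_ : 0 = 0.*2) // Uf Uw add0n fw ww Cf Cw.
Qed.

Lemma braid_word_fits p w : on_strands p w ->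
  fits p.*2 (braid_word w) /\ width p.*2 (braid_word w) = p.*2.
Proof.
elim: w => //= i w IHw /andP[lti /IHw[fw ww]].
have le2 : i + 2 <= p.*2 by rewrite addn2 -addnn; lia.
by rewrite le2 subnK // (leq_trans _ le2) ?leq_addl.
Qed.

Lemma tl_word_fits p w : on_strands p w ->
  fits p.*2 (tl_word w) /\ width p.*2 (tl_word w) = p.*2.
Proof.
elim: w => //= i w IHw /andP[lti /IHw[fw ww]].
have le2 : i + 2 <= p.*2 by rewrite addn2 -addnn; lia.
have E : p.*2 - 2 + 0 - 0 + 2 = p.*2.
  by rewrite addn0 subn0 subnK // (leq_trans _ le2) ?leq_addl.
by rewrite E fw ww le2 addn0 /= andbT; split=> //; lia.
Qed.

Lemma closed_braid_word p w :
  on_strands p w -> Defs.closed (closure_word p (braid_word w)).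
Proof. by move=> /braid_word_fits[? ?]; apply: closed_closure. Qed.

Definition closed_braid p w (pw : on_strands p w) : diagram :=
  Diagram (closed_braid_word pw).

Lemma diagram_eq (D E : diagram) : word D = word E -> D = E.
Proof.
case: D E => [u cu] [v cv] /= uv; subst v.
by rewrite (bool_irrelevance cu cv).
Qed.

(** * The positive braid monoid and isotopy of closures *)

Inductive braid_step : seq nat -> seq nat -> Prop :=
| braid_step_far u v i j : i.+1 < j ->
    braid_step (u ++ [:: i; j] ++ v) (u ++ [:: j; i] ++ v)
| braid_step_R3 u v i :
    braid_step (u ++ [:: i; i.+1; i] ++ v) (u ++ [:: i.+1; i; i.+1] ++ v).

Definition braid_equiv : seq nat -> seq nat -> Prop :=
  clos_refl_sym_trans _ braid_step.

Lemma braid_equiv_refl u : braid_equiv u u.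
Proof. exact: rst_refl. Qed.

Lemma braid_equiv_sym u v : braid_equiv u v -> braid_equiv v u.
Proof. exact: rst_sym. Qed.

Lemma braid_equiv_trans v u w :
  braid_equiv u v -> braid_equiv v w -> braid_equiv u w.
Proof. exact: rst_trans. Qed.

Lemma braid_equiv_ctx a b u v :
  braid_equiv u v -> braid_equiv (a ++ u ++ b) (a ++ v ++ b).
Proof.
elim=> {u v} [_ _ []|u|u v _|u v w _ + _].
- move=> u v i j far; apply: rst_step.
  by rewrite -!catA ![a ++ u ++ _]catA; apply: braid_step_far.
- move=> u v i; apply: rst_step.
  by rewrite -!catA ![a ++ u ++ _]catA; apply: braid_step_R3.
- exact: rst_refl.
- exact: rst_sym.
- exact: rst_trans.
Qed.

Lemma braid_equiv_cat u u' v v' :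
  braid_equiv u u' -> braid_equiv v v' -> braid_equiv (u ++ v) (u' ++ v').
Proof.
move=> uu' vv'; apply: (@braid_equiv_trans (u' ++ v)).
  exact: (braid_equiv_ctx [::] v uu').
by have := braid_equiv_ctx u' [::] vv'; rewrite !cats0.
Qed.

Lemma closed_braid_isotopic p u v (pu : on_strands p u) (pv : on_strands p v) :
  braid_equiv u v -> isotopic (closed_braid pu) (closed_braid pv).
Proof.
(* Transitivity passes through a word that must also lie on [p] strands, so the invariance of
   [on_strands] is proved in the same induction. *)
move=> uv; suff [_] : on_strands p u = on_strands p v /\ forall pu pv,
  isotopic (@closed_braid p u pu) (@closed_braid p v pv) by [].
elim: uv => {u v pu pv}
  [_ _ []|u|u v _ [Euv iso]|u v w _ [Euv isouv] _ [Evw isovw]].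
- move=> u v i j far; split=> [|pu pv].
    rewrite /on_strands !all_cat /=.
    by case: (i.+1 < p); case: (j.+1 < p); rewrite //= ?andbF.
  apply: rst_step; exists ([seq (Cup, i) | i <- iota 0 p] ++ braid_word u).
  exists [:: (Crossing true, i); (Crossing true, j)].
  exists [:: (Crossing true, j); (Crossing true, i)].
  exists (braid_word v ++ [seq (Cap, i) | i <- rev (iota 0 p)]).
  rewrite /= /closure_word /braid_word !map_cat -!catA; split=> //.
  (* [j - i.+2] strands separate the two letters. *)
  have := move_exchange (Crossing true) (Crossing true) i (j - i.+2).
  by rewrite /= (_ : i + 2 + (j - i.+2) = j) //; lia.
- move=> u v i; split=> [|pu pv].
    rewrite /on_strands !all_cat /=.
    by case: (i.+1 < p); case: (i.+2 < p); rewrite //= ?andbF.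
  apply: rst_step; exists ([seq (Cup, i) | i <- iota 0 p] ++ braid_word u).
  exists [:: (Crossing true, i); (Crossing true, i.+1); (Crossing true, i)].
  exists [:: (Crossing true, i.+1); (Crossing true, i); (Crossing true, i.+1)].
  exists (braid_word v ++ [seq (Cap, i) | i <- rev (iota 0 p)]).
  rewrite /= /closure_word /braid_word !map_cat -!catA; split=> //.
  exact: move_R3.
- by split=> // pu pu'; rewrite (bool_irrelevance pu pu'); apply: rst_refl.
- by split=> [//|pv pu]; apply: rst_sym; apply: iso.
- split=> [|pu pw]; first by rewrite Euv.
  have pv : on_strands p v by rewrite -Euv.
  apply: rst_trans (isouv pu pv) _; exact: isovw.
Qed.

Lemma torus_link_closed_braid p q w (pw : on_strands p w) :
  braid_equiv (power (iota 0 p.-1) q) w -> torus_link p q (closed_braid pw).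
Proof.
move=> Dw; have pD : on_strands p (power (iota 0 p.-1) q).
  by apply: all_power; apply/allP => i; rewrite mem_iota; lia.
have -> : torus_link p q = link_of (closed_braid pD).
  congr link_of; apply: diagram_eq => /=; congr closure_word.
  by rewrite /torus_braid /power /braid_word map_flatten map_nseq.
exact: closed_braid_isotopic.
Qed.

(** * Testing braid equivalence by division *)

(* Garside: a positive word divisible on the left by i and by an adjacent
   letter j is divisible by the least common multiple i j i = j i j. *)
Fixpoint braid_pull (n i : nat) (w : seq nat) : option (seq nat) :=
  match n, w with
  | n'.+1, j :: w' =>
      if j == i then Some w'
      else if (i.+1 < j) || (j.+1 < i) then omap (cons j) (braid_pull n' i w')
      else if braid_pull n' i w' is Some w1 then
        if braid_pull n' j w1 is Some w2 then Some [:: j, i & w2] else None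
      else None
  | _, _ => None
  end.

(** Divides [u] on the left by the letters of [v] in turn. The fuel [size u] suffices, because
    pulling out a letter shortens the word by one. *)
Fixpoint braid_eqb (u v : seq nat) : bool :=
  if v is i :: v' then
    if braid_pull (size u) i u is Some u' then braid_eqb u' v' else false
  else nilp u.

Lemma braid_equiv_cons i u v : braid_equiv u v -> braid_equiv (i :: u) (i :: v).
Proof.
by move=> uv; have := braid_equiv_ctx [:: i] [::] uv; rewrite /= !cats0.
Qed.

Lemma braid_equiv_swap i j w : i.+1 < j \/ j.+1 < i ->
  braid_equiv [:: j, i & w] [:: i, j & w].
Proof.
case=> far; last exact/rst_step/(braid_step_far [::] w far).
exact/braid_equiv_sym/rst_step/(braid_step_far [::] w far).
Qed.

Lemma braid_equiv_R3 i j w : i.+1 = j \/ j.+1 = i ->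
  braid_equiv [:: j, i, j & w] [:: i, j, i & w].
Proof.
case=> <-; last exact/rst_step/(braid_step_R3 [::] w).
exact/braid_equiv_sym/rst_step/(braid_step_R3 [::] w).
Qed.

Lemma braid_pullP n i w w' :
  braid_pull n i w = Some w' -> braid_equiv w (i :: w').
Proof.
elim: n i w w' => [|n IHn] i [|j w] w' //=.
case: eqP => [-> [->]|ji]; first exact: braid_equiv_refl.
case: ifP => [/orP far|/negbT/norP[]].
  case E: (braid_pull n i w) => [w1|] //= [<-].
  apply: braid_equiv_trans (braid_equiv_cons j (IHn _ _ _ E)) _.
  exact: braid_equiv_swap.
rewrite -!leqNgt => ji1 ij1.
case E: (braid_pull n i w) => [w1|] //.
case E1: (braid_pull n j w1) => [w2|] //= [<-].
apply: braid_equiv_trans (braid_equiv_cons j (IHn _ _ _ E)) _.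
apply: (@braid_equiv_trans [:: j, i, j & w2]).
  by do 2!apply: braid_equiv_cons; apply: IHn.
by apply: braid_equiv_R3; lia.
Qed.

Lemma braid_eqbP u v : braid_eqb u v -> braid_equiv u v.
Proof.
elim: v u => [|i v IHv] u /=; first by move=> /nilP->; apply: braid_equiv_refl.
case E: (braid_pull _ i u) => [u'|] // /IHv u'v.
exact: braid_equiv_trans (braid_pullP E) (braid_equiv_cons i u'v).
Qed.

Lemma braid_equiv_power u v n :
  braid_equiv u v -> braid_equiv (power u n) (power v n).
Proof.
move=> uv; elim: n => [|n IHn]; first exact: braid_equiv_refl.
exact: braid_equiv_cat.
Qed.

Lemma braid_equiv_comm_power u v n : braid_equiv (u ++ v) (v ++ u) ->
  braid_equiv (power u n ++ v) (v ++ power u n).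
Proof.
move=> uv; elim: n => [|n IHn]; first by rewrite cats0; apply: braid_equiv_refl.
rewrite powerS -catA; apply: (@braid_equiv_trans (u ++ v ++ power u n)).
  by apply: braid_equiv_cat => //; apply: braid_equiv_refl.
by rewrite !catA; apply: braid_equiv_cat => //; apply: braid_equiv_refl.
Qed.

Lemma braid_equiv_power_cat u v n : braid_equiv (u ++ v) (v ++ u) ->
  braid_equiv (power (u ++ v) n) (power u n ++ power v n).
Proof.
move=> uv; elim: n => [|n IHn]; first exact: braid_equiv_refl.
apply: (@braid_equiv_trans (u ++ v ++ power u n ++ power v n)).
  rewrite powerS -catA.
  by do !apply: braid_equiv_cat => //; apply: braid_equiv_refl.
rewrite !powerS -catA; apply: braid_equiv_cat; first exact: braid_equiv_refl.
rewrite !catA; apply: braid_equiv_cat; last exact: braid_equiv_refl.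
exact/braid_equiv_sym/braid_equiv_comm_power.
Qed.

(** * Connectedness of closed braids *)

Lemma fits_nth n w k : fits n w -> k < size w ->
  (nth (Cup, 0) w k).2 + ins (nth (Cup, 0) w k).1 <= width n (take k w) /\
  width n (take k.+1 w) =
    width n (take k w) - ins (nth (Cup, 0) w k).1 + outs (nth (Cup, 0) w k).1.
Proof.
elim: w n k => //= q w IHw n [|k] /andP[le_n fw] /= ltk.
  by rewrite take0.
exact: IHw.
Qed.

(** A crossing, being a vertex, glues its two columns; as every generator occurs, the first [p]
    columns of the braid are linked. All other points are reached through the cups, or downwards
    from the caps. *)
Lemma closed_braid_connected p w (pw : on_strands p w) :
  0 < p -> (forall i, i.+1 < p -> i \in w) -> connected (closed_braid pw).
Proof.
move=> p0 full; apply/eqP; rewrite /=.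
have := closed_braid_word pw; set W := closure_word p _ => /andP[fW _].
have szW : size W = p + size w + p.
  by rewrite /W /closure_word !size_cat !size_map size_rev size_iota addnA.
have nthU k : k < p -> nth (Cup, 0) W k = (Cup, k).
  move=> ltk; rewrite /W /closure_word nth_cat size_map size_iota ltk.
  by rewrite (nth_map 0) ?size_iota // nth_iota.
have nthX k : k < size w -> nth (Cup, 0) W (p + k) = (Crossing true, nth 0 w k).
  move=> ltk; rewrite /W /closure_word nth_cat size_map size_iota.
  rewrite ltnNge leq_addr /= addKn nth_cat size_map ltk.
  by rewrite (nth_map 0).
have nthC k : k < p -> (nth (Cup, 0) W (p + size w + k)).1 = Cap.
  move=> ltk; rewrite /W /closure_word catA nth_cat size_cat.
  rewrite !size_map size_iota.
  rewrite ltnNge leq_addr /= addKn.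
  by rewrite (nth_map 0) ?size_rev ?size_iota.
have step k ltk := @fits_nth _ _ k fW ltk.
have wU k : k <= p -> width 0 (take k W) = k.*2.
  elim: k => [|k IHk] ltk; first by rewrite take0.
  have [|_ ->] := step k; first by rewrite szW; lia.
  by rewrite nthU // IHk 1?ltnW // subn0 addn2.
have lt_w i : i \in w -> i.+1 < p by move=> iw; apply: (allP pw).
have wX k : k <= size w -> width 0 (take (p + k) W) = p.*2.
  elim: k => [|k IHk] ltk; first by rewrite addn0 wU.
  have [|le2 Ew] := step (p + k); first by rewrite szW; lia.
  have {}IHk := IHk (ltnW ltk).
  by move: le2; rewrite addnS Ew IHk ?nthX //=; lia.
apply: (@components_eq1 _ p 0); first by rewrite szW; lia.
  by rewrite wU // double_gt0.
move=> g gW.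
have gU k j : k < p -> j < k -> g k.+1 j = g k j.
  move=> ltk ltj; have := gW k true false j j; rewrite addn1 addn0; apply.
  - by rewrite szW; lia.
  - by rewrite wU //; lia.
  - by rewrite wU //; lia.
  - by rewrite nthU // /joined /strand /= ltj eqxx orbT.
have gU2 k j : k < p -> k <= j < k.*2 -> g k.+1 (j + 2) = g k j.
  move=> ltk /andP[lej ltj].
  have := gW k true false (j + 2) j; rewrite addn1 addn0; apply.
  - by rewrite szW; lia.
  - by rewrite wU //; lia.
  - by rewrite wU //; lia.
  - rewrite nthU // /joined /strand /= ltnNge lej addn0 lej subn0 eqxx.
    by rewrite orbT.
have gUU k : k < p -> g k.+1 k.+1 = g k.+1 k.
  move=> ltk; have := gW k true true k.+1 k; rewrite addn1; apply.
  - by rewrite szW; lia.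
  - by rewrite wU //; lia.
  - by rewrite wU //; lia.
  - by rewrite nthU // /joined /event_end /= addn2 leqnn !ltnS leqnSn leqnn.
(* All four ends at a crossing belong to one vertex, so [g] keeps its value along each column of the
   braid. *)
have gX k j : k < size w -> j < p.*2 -> g (p + k).+1 j = g (p + k) j.
  move=> ltk ltj; have := gW (p + k) true false j j; rewrite addn1 addn0; apply.
  - by rewrite szW; lia.
  - by rewrite -addnS wX.
  - by rewrite wX // ltnW.
  - rewrite nthX // /joined /event_end /strand /=; set i := nth 0 w k.
    case: ltnP => //= leij; case: ltnP => //= ?;
      by rewrite ?subnK ?eqxx ?orbT //; lia.
have gX2 k : k < size w -> g (p + k) (nth 0 w k).+1 = g (p + k) (nth 0 w k).
  move=> ltk; set i := nth 0 w k; have lti : i.+1 < p by apply/lt_w/mem_nth.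
  have := gW (p + k) false false i.+1 i; rewrite addn0; apply.
  - by rewrite szW; lia.
  - by rewrite (wX _ (ltnW ltk)) -addnn ltn_addr.
  - by rewrite (wX _ (ltnW ltk)) -addnn ltn_addr // ltnW.
  - by rewrite nthX // -/i /joined /event_end /= addn2 leqnn !ltnS leqnSn leqnn.
have gXp k j : k <= size w -> j < p.*2 -> g (p + k) j = g p j.
  elim: k => [|k IHk] ltk ltj; first by rewrite addn0.
  by rewrite addnS gX // IHk // ltnW.
have gp j : j < p -> g p j = g p 0.
  elim: j => // j IHj ltj; rewrite -IHj 1?ltnW //.
  have ltk : index j w < size w by rewrite index_mem full.
  have := gX2 _ ltk; rewrite nth_index ?full //.
  by rewrite !gXp //; lia.
have gk1 m k j : k + m = p -> j < k -> g k j = g p 0.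
  elim: m k => [|m IHm] k; first by rewrite addn0 => -> ?; apply: gp.
  move=> km ltj; rewrite -gU //; first by apply: IHm; lia.
  by lia.
(* By induction on the number of cups: points up to the left end of the newest cup run up to line
   [p], its right end is joined to the left one, and points further right go down to the preceding
   line. *)
have gk k j : k <= p -> j < k.*2 -> g k j = g p 0.
  elim: k j => // k IHk j ltk ltj.
  have [ltjk|lekj] := ltnP j k.+1; first by apply: (gk1 (p - k.+1)) => //; lia.
  have [->|nej] := eqVneq j k.+1.
    by rewrite gUU //; apply: (gk1 (p - k.+1)); lia.
  have -> : j = (j - 2) + 2 by lia.
  by rewrite gU2 ?IHk //; lia.
(* A cap has no upper ends, so every point above it continues a strand from the line below. *)
have gC k j : k <= p -> j < width 0 (take (p + size w + k) W) ->
    g (p + size w + k) j = g p 0.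
  elim: k j => [|k IHk] j ltk.
    by rewrite addn0 wX // => ltj; rewrite gXp // gk.
  have [|le2 Ew] := step (p + size w + k); first by rewrite szW; lia.
  rewrite addnS Ew => ltj.
  have := nthC _ ltk; move: le2 Ew ltj.
  case E: (nth _ _ _) => [e i] /= le2 Ew ltj Ee.
  rewrite {e}Ee /= in E le2 Ew ltj.
  have [ltji|leij] := ltnP j i.
    rewrite -(IHk j (ltnW ltk)); last by lia.
    have := gW (p + size w + k) true false j j; rewrite addn1 addn0; apply.
    + by rewrite szW; lia.
    + by rewrite Ew.
    + by lia.
    + by rewrite E /joined /strand /= ltji eqxx orbT.
  rewrite -(IHk (j + 2) (ltnW ltk)); last by lia.
  have := gW (p + size w + k) true false j (j + 2); rewrite addn1 addn0; apply.
  + by rewrite szW; lia.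
  + by rewrite Ew.
  + by lia.
  + rewrite E /joined /strand /= ifN -?leqNgt; last by lia.
    by rewrite leq_add2r leij addnK addn0 eqxx orbT.
move=> k j lek ltj; have [ltkp|lepk] := ltnP k p.
  by apply: gk; [|rewrite -wU //]; apply: ltnW.
have [ltkw|lewk] := ltnP k (p + size w).
  have Ek : k = p + (k - p) by lia.
  move: ltj; rewrite Ek wX; last by lia.
  by move=> ltj; rewrite gXp ?gk //; lia.
have Ek : k = p + size w + (k - (p + size w)) by lia.
by move: ltj; rewrite Ek; apply: gC; lia.
Qed.

(** * States and genus of a closed positive braid *)

Lemma state_word a p w :
  flatten [seq resolve a q | q <- closure_word p (braid_word w)]
  = closure_word p (if a then [::] else tl_word w).
Proof.
have id_map (e : event) s : (if e is Crossing _ then false else true) ->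
    flatten [seq resolve a q | q <- [seq (e, i) | i <- s]]
    = [seq (e, i) | i <- s].
  by case: e => // _; elim: s => //= i s ->.
rewrite /closure_word !map_cat !flatten_cat (id_map Cup) // (id_map Cap) //.
congr (_ ++ (_ ++ _)).
(* The A-resolution of a positive crossing is a pair of vertical strands, the B-resolution a
   Temperley-Lieb letter. *)
by elim: w => [|i w /= ->]; case: (a).
Qed.

Lemma crossings_closed_braid p w (pw : on_strands p w) :
  crossings (closed_braid pw) = size w.
Proof.
rewrite /crossings /closure_word /= !count_cat !count_map.
rewrite (eq_count (a2 := pred0)) // count_pred0 (eq_count (a2 := predT)) //.
by rewrite count_predT (eq_count (a2 := pred0)) // count_pred0 addn0.
Qed.

(* The labels below b are those of v, the others those of the circles removed
   in the reduction to v. *)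
Lemma tl_components_ge p u v k b L (s : nat -> nat) :
    on_strands p u -> tl_reduces k u v -> tl_labelled v L s s ->
    (forall j, j < p -> s (p.*2.-1 - j) = s j) ->
    (forall c, c < b -> exists2 j, j < p & s j = c) ->
  b + k <= components (closure_word p (tl_word u)).
Proof.
move=> pu uv vL sym_s surj.
have [|L' uL' sub] := uv (iota b k) _ _ _ _ vL; first by rewrite size_iota.
have [t lab] := closure_labelled sym_s (tl_wordP uL').
have [fu wu] := tl_word_fits pu.
rewrite -(size_iota 0 (b + k)).
apply: labelled_components_ge lab (iota_uniq _ _) _.
  by have /andP[] := closed_closure fu wu.
move=> c; rewrite iotaD mem_cat => /orP[|cF].
  rewrite mem_iota add0n => /surj[j ltj <-].
  by rewrite mem_cat map_f // mem_iota.
by rewrite mem_cat sub ?orbT // mem_cat cF.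
Qed.

(** The all-A state is the closure of the trivial braid, [p] nested circles; circle [j] gets the
    label [j]. *)
Lemma s_A_closed_braid p w (pw : on_strands p w) : p <= s_A (closed_braid pw).
Proof.
rewrite /s_A /state_circles state_word -[leqLHS]addn0.
apply: (@tl_components_ge p [::] [::] 0 p [::]
  (fun j => if j < p then j else p.*2.-1 - j)) => //.
- exact: tl_reduces_refl.
- by move=> j ltj; rewrite ltj ifN; lia.
- by move=> j ltj; exists j; rewrite ?ltj.
Qed.

(** Each cup takes over the label of the cap below it, so the state never changes. *)
Lemma tl_labelled_fixed w (s : nat -> nat) :
  all (fun i => s i == s i.+1) w -> tl_labelled w [seq s i | i <- w] s s.
Proof.
elim: w => //= i w IHw /andP[/eqP si /IHw sw]; split=> //.
suff -> : set_pair i (s i) s = s by [].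
apply: functional_extensionality => j; rewrite set_pairE.
by case: eqP => [->|_] //=; case: eqP => [->|].
Qed.

(** The numerical hypothesis is 2 + c - s_A - s_B <= 2g with s_A and s_B replaced by the lower
    bounds [p] and [b + k]: [k] circles come from the reduction to [v], and [s] tells apart [b]
    components of the closure of [v]. *)
Lemma torus_genus_le p q w v k b (s : nat -> nat) (g : nat) :
    0 < p -> {subset iota 0 p.-1 <= w} -> on_strands p w ->
    braid_equiv (power (iota 0 p.-1) q) w ->
    tl_reduces k w v -> all (fun i => s i == s i.+1) v ->
    (forall j, j < p -> s (p.*2.-1 - j) = s j) ->
    (forall c, c < b -> exists2 j, j < p & s j = c) ->
    2 + size w <= p + (b + k) + g.*2 ->
  turaev_genus (torus_link p q) <= g.
Proof.
move=> p0 full pw Dw wv /tl_labelled_fixed vL sym_s surj le_g.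
apply: (@turaev_genus_le _ (closed_braid pw)).
- exact: torus_link_closed_braid.
- apply: closed_braid_connected => // i lti.
  by apply: full; rewrite mem_iota; lia.
have leA := s_A_closed_braid pw.
have leB : b + k <= s_B (closed_braid pw).
  rewrite /s_B /state_circles state_word.
  exact: tl_components_ge pw wv vL sym_s surj.
rewrite /diagram_genus crossings_closed_braid -[g]doubleK; apply: half_leq.
rewrite leq_subLR (leq_trans le_g) // leq_add2r.
exact: leq_add.
Qed.

Lemma tl_reduces_moves ms k u v : tl_moves ms u = (k, v) -> tl_reduces k u v.
Proof. by move=> E; have := @tl_movesP ms u; rewrite E. Qed.

(** * Four strands *)

(* Strands 0, 1 cross strands 2, 3. *)
Definition ribbon_crossing : seq nat := [:: 1; 0; 2; 1].

(* Equivalent to ribbon_crossing ++ [:: 3; 2; 1; 0; 0; 1; 2; 3]. *)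
Definition crossing_turn : seq nat := [:: 3; 1; 2; 1; 1; 0; 1; 3; 1; 2; 1; 3].

(** After e_0 e_2 the first ribbon crossing gives one circle and leaves a final e_1. This e_1 meets
    the initial e_1 of the next crossing, which therefore gives a second circle. *)
Lemma tl_reduces_ribbon_crossing n :
  tl_reduces (1 + n * 2) ([:: 0; 2] ++ power ribbon_crossing n.+1) [:: 0; 2; 1].
Proof.
rewrite powerS catA.
apply: (@tl_reduces_trans _ _ _ ([:: 0; 2; 1] ++ power ribbon_crossing n)).
  rewrite -[1]addn0; apply: tl_reduces_cat; last exact: tl_reduces_refl.
  exact: (@tl_reduces_moves [:: 0; 1; 0; 1]).
apply: tl_reduces_power.
exact: (@tl_reduces_moves [:: 2; 0; 1; 0; 1]).
Qed.

Definition twist4 (a b c : nat) : seq nat :=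
  power [:: 0] a ++ power [:: 2] b ++ power ribbon_crossing c.

Lemma tl_reduces_twist4 a b c :
  tl_reduces (a + b + (1 + c * 2)) (twist4 a.+1 b.+1 c.+1) [:: 0; 2; 1].
Proof.
rewrite /twist4 catA.
apply: tl_reduces_trans (@tl_reduces_ribbon_crossing c); rewrite -[a + b]addn0.
apply: tl_reduces_cat; last exact: tl_reduces_refl.
exact: tl_reduces_cat (@tl_reduces_letter 0 a) (@tl_reduces_letter 2 b).
Qed.

Lemma twist4_on_strands p a b c : 3 < p -> on_strands p (twist4 a b c).
Proof.
move=> p3; rewrite /on_strands /twist4 !all_cat !all_power //= ?andbT; lia.
Qed.

Lemma size_twist4 a b c : size (twist4 a b c) = a + b + 4 * c.
Proof. by rewrite /twist4 !size_cat !size_power /=; lia. Qed.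

(** The rewriting of one full twist and the commutation of its factors, which separates the powers,
    are finite checks by [braid_eqb]. *)
Lemma full_twist4 n :
  braid_equiv (power (iota 0 3) (4 * n)) (twist4 (2 * n) (2 * n) (2 * n)).
Proof.
rewrite powerM /twist4 !powerM.
apply: (@braid_equiv_trans
  (power ([:: 0; 0] ++ [:: 2; 2] ++ power ribbon_crossing 2) n)).
  by apply/braid_equiv_power/braid_eqbP; vm_compute.
apply: (@braid_equiv_trans
  (power [:: 0; 0] n ++ power ([:: 2; 2] ++ power ribbon_crossing 2) n)).
  by apply/braid_equiv_power_cat/braid_eqbP; vm_compute.
apply: braid_equiv_cat; first exact: braid_equiv_refl.
by apply/braid_equiv_power_cat/braid_eqbP; vm_compute.
Qed.

(** The extra factor (s_1 s_2 s_3)^2 equals s_1^2 X. A single X carries s_1 to s_3, but X^2 commutes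
    with s_1^2, which can thus be moved to the left past the even power of X. *)
Lemma odd_half_twist4 n : braid_equiv (power (iota 0 3) (4 * n + 2))
  (twist4 (2 * n + 2) (2 * n) (2 * n + 1)).
Proof.
rewrite powerD; apply: (@braid_equiv_trans
  (twist4 (2 * n) (2 * n) (2 * n) ++ [:: 0; 0] ++ ribbon_crossing)).
  by apply: braid_equiv_cat (full_twist4 n) _; apply: braid_eqbP; vm_compute.
set A := power [:: 0] (2 * n); set B := power [:: 2] (2 * n).
set C := power ribbon_crossing (2 * n); rewrite /twist4 -/A -/B -/C.
have -> : power [:: 0] (2 * n + 2) = A ++ [:: 0; 0] by exact: powerD.
have -> : power ribbon_crossing (2 * n + 1) = C ++ ribbon_crossing.
  exact: powerD.
rewrite -!(catA A) -!(catA B); apply: braid_equiv_cat.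
  exact: braid_equiv_refl.
rewrite !(catA _ _ ribbon_crossing).
apply: braid_equiv_cat; last exact: braid_equiv_refl.
apply: (@braid_equiv_trans (B ++ [:: 0; 0] ++ C)).
  apply: braid_equiv_cat; first exact: braid_equiv_refl.
  by rewrite /C powerM; apply/braid_equiv_comm_power/braid_eqbP; vm_compute.
rewrite !catA; apply: braid_equiv_cat; last exact: braid_equiv_refl.
by apply/braid_equiv_comm_power/braid_eqbP; vm_compute.
Qed.

(** From the second on, each letter of a ribbon twist is paid for by a circle; each further X has
    four letters and two circles, so it adds one to the bound. *)
Lemma torus_genus4 q a b c :
  braid_equiv (power (iota 0 3) q) (twist4 a.+1 b.+1 c.+1) ->
  turaev_genus (torus_link 4 q) <= c.+1.
Proof.
move=> Dw.
apply: (@torus_genus_le 4 q _ [:: 0; 2; 1] _ 1 (fun=> 0)) Dw _ _ _ _ _ => //.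
- by apply/allP; rewrite /= !mem_cat !inE /= ?orbT.
- exact: twist4_on_strands.
- exact: tl_reduces_twist4.
- by case=> // _; exists 0.
- by rewrite size_twist4; lia.
Qed.

Lemma tl_reduces_catr k u v w :
  tl_reduces k u v -> tl_reduces k (u ++ w) (v ++ w).
Proof.
move=> uv; rewrite -[k]addn0.
by apply: tl_reduces_cat uv _; apply: tl_reduces_refl.
Qed.

(** * Five strands *)

Definition twist5 (n : nat) : seq nat :=
  power [:: 0] (2 * n) ++ power [:: 2] (2 * n) ++
  power ribbon_crossing n ++ power crossing_turn n.

Lemma tl_reduces_twist5 n :
  tl_reduces (12 * n + 8) (twist5 n.+1) [:: 0; 2; 1; 3].
Proof.
have -> : twist5 n.+1 =
    twist4 (2 * n).+2 (2 * n).+2 n.+1 ++ crossing_turn ++ power crossing_turn n.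
  by rewrite /twist5 (_ : 2 * n.+1 = (2 * n).+2) -?catA //; lia.
(* The first [crossing_turn] gives five circles. Each later one gives six, since its initial 3 meets
   the final 3 of the reduced word before it. *)
have -> : 12 * n + 8 =
    (2 * n).+1 + (2 * n).+1 + (1 + n * 2) + (5 + n * 6) by lia.
apply: (tl_reduces_trans (tl_reduces_catr (@tl_reduces_twist4 _ _ _))).
rewrite catA.
apply: (@tl_reduces_trans _ _ _ ([:: 0; 2; 1; 3] ++ power crossing_turn n)).
  apply/tl_reduces_catr.
  exact: (@tl_reduces_moves [:: 4; 4; 4; 6; 2; 3; 2; 3; 2; 3; 2; 3]).
apply: tl_reduces_power.
exact: (@tl_reduces_moves [:: 3; 4; 4; 4; 6; 2; 3; 2; 3; 2; 3; 2; 3]).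
Qed.

Lemma full_twist5 n : braid_equiv (power (iota 0 4) (5 * n)) (twist5 n).
Proof.
rewrite powerM /twist5 !powerM; apply: (@braid_equiv_trans
  (power ([:: 0; 0] ++ [:: 2; 2] ++ ribbon_crossing ++ crossing_turn) n)).
  by apply/braid_equiv_power/braid_eqbP; vm_compute.
do 2!(apply: braid_equiv_trans (braid_equiv_power_cat _ _) _;
  [by apply: braid_eqbP; vm_compute|];
  apply: braid_equiv_cat; first exact: braid_equiv_refl).
by apply/braid_equiv_power_cat/braid_eqbP; vm_compute.
Qed.

Lemma size_twist5 n : size (twist5 n) = 20 * n.
Proof. by rewrite !size_cat !size_power /=; lia. Qed.

(** A full twist has 20 letters and each further one adds 12 circles, so the bound grows by (20 -
    12) / 2 = 4. *)
Lemma torus_genus5 n : turaev_genus (torus_link 5 (5 * n.+1)) <= 4 * n.+1.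
Proof.
apply: (@torus_genus_le 5 _ (twist5 n.+1) [:: 0; 2; 1; 3] _ 1 (fun=> 0)) => //.
- by apply/allP; rewrite /= !mem_cat !inE /= ?orbT.
- by rewrite /on_strands !all_cat !all_power.
- exact: full_twist5.
- exact: tl_reduces_twist5.
- by case=> // _; exists 0.
- by rewrite size_twist5; lia.
Qed.

(** * Six strands *)

(* The words l, r and U of the header: l ++ r is equivalent to the product
   [:: 1; 0; 2; 1; 3; 2; 4; 3] of two ribbon crossings, and U to r ++ l. *)
Definition ribbon_cycle_l : seq nat := [:: 1; 0; 2; 3].
Definition ribbon_cycle_r : seq nat := [:: 1; 4; 2; 3].
Definition ribbon_cycle : seq nat := [:: 2; 1; 2; 0; 2; 4; 3; 2].

Definition twist6 (n : nat) : seq nat :=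
  power [:: 0] (2 * n) ++ power [:: 2] (2 * n) ++ power [:: 4] (2 * n) ++
  ribbon_cycle_l ++ power ribbon_cycle (3 * n).-1 ++ ribbon_cycle_r.

Lemma tl_reduces_twist6 n :
  tl_reduces (18 * n + 12) (twist6 n.+1) [:: 0; 2; 4; 3].
Proof.
(* The three ribbon twists come first; then l U gives 4 circles, each of the [(3 * n).+1] other
   factors U gives 4, and r gives one. *)
have -> : 18 * n + 12 =
    (2 * n).+1 + ((2 * n).+1 + ((2 * n).+1 + 0)) + (4 + (3 * n).+1 * 4 + 1).
  by lia.
rewrite /twist6 (_ : 2 * n.+1 = (2 * n).+2); last by lia.
rewrite (_ : (3 * n.+1).-1 = (3 * n).+2); last by lia.
apply: tl_reduces_trans.
  apply: tl_reduces_cat (@tl_reduces_letter 0 _) _.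
  apply: tl_reduces_cat (@tl_reduces_letter 2 _) _.
  by apply: tl_reduces_cat (@tl_reduces_letter 4 _) _; apply: tl_reduces_refl.
rewrite powerS.
apply: (@tl_reduces_trans _ _ _ ([:: 0; 2; 4] ++ ribbon_cycle_r)).
  have catE P : [:: 0] ++ [:: 2] ++ [:: 4] ++ ribbon_cycle_l ++
        (ribbon_cycle ++ P) ++ ribbon_cycle_r
      = (([:: 0; 2; 4] ++ ribbon_cycle_l ++ ribbon_cycle) ++ P) ++
        ribbon_cycle_r.
    by rewrite -!catA.
  rewrite catE.
  apply: tl_reduces_catr.
  apply: (@tl_reduces_trans _ _ _
    ([:: 0; 2; 4] ++ power ribbon_cycle (3 * n).+1)).
    apply: tl_reduces_catr.
    exact: (@tl_reduces_moves [:: 5; 5; 4; 5; 1; 2; 2; 3; 0; 1; 2; 3; 0; 1; 1]).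
  apply: tl_reduces_power.
  exact: (@tl_reduces_moves [:: 3; 1; 2; 2; 3; 0; 1; 2; 3; 0; 1; 1]).
exact: (@tl_reduces_moves [:: 2; 3; 3; 1]).
Qed.

Lemma full_twist6 n : braid_equiv (power (iota 0 5) (6 * n.+1)) (twist6 n.+1).
Proof.
rewrite powerM /twist6 !powerM; apply: (@braid_equiv_trans
  (power ([:: 0; 0] ++ [:: 2; 2] ++ [:: 4; 4] ++
     power (ribbon_cycle_l ++ ribbon_cycle_r) 3) n.+1)).
  by apply/braid_equiv_power/braid_eqbP; vm_compute.
do 3!(apply: braid_equiv_trans (braid_equiv_power_cat _ _) _;
  [by apply: braid_eqbP; vm_compute|];
  apply: braid_equiv_cat; first exact: braid_equiv_refl).
(* The exponent is positive, so (l r)^(3n+3) = l (r l)^(3n+2) r, and r l is then replaced by U. *)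
rewrite -powerM -[3 * n.+1]prednK // power_rotate.
apply: braid_equiv_cat; first exact: braid_equiv_refl.
apply: braid_equiv_cat; last exact: braid_equiv_refl.
by apply/braid_equiv_power/braid_eqbP; vm_compute.
Qed.

Lemma size_twist6 n : 0 < n -> size (twist6 n) = 30 * n.
Proof. by move=> n0; rewrite !size_cat !size_power /=; lia. Qed.

Lemma torus_genus6 n : turaev_genus (torus_link 6 (6 * n.+1)) <= 6 * n.+1.
Proof.
(* In the closure of e_0 e_2 e_4 e_3, strands 0 and 1 are separate from strands 2 to 5. The labels 0
   and 1 record this and are mirrored on the closing strands 6 to 11. *)
pose s j := nat_of_bool (1 < j < 10).
apply: (@torus_genus_le 6 _ (twist6 n.+1) [:: 0; 2; 4; 3] _ 2 s) => //.
- by apply/allP; rewrite /= !mem_cat !inE /= ?orbT.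
- by rewrite /on_strands !all_cat !all_power.
- exact: full_twist6.
- exact: tl_reduces_twist6.
- by do 6!case=> //.
- by case=> [|[|]] // _; [exists 0|exists 2].
- by rewrite size_twist6 //; lia.
Qed.

Theorem theorem4p7 (n : nat) (hn : 1 <= n) :
  [/\ turaev_genus (torus_link 4 (4 * n)) <= 2 * n,
      turaev_genus (torus_link 4 (4 * n + 2)) <= 2 * n + 1,
      turaev_genus (torus_link 5 (5 * n)) <= 4 * n
    & turaev_genus (torus_link 6 (6 * n)) <= 6 * n].
Proof.
case: n hn => // n _; split.
- have E : 2 * n.+1 = (2 * n).+2 by lia.
  rewrite E; apply: torus_genus4; rewrite -E; exact: full_twist4.
- have E : 2 * n.+1 = (2 * n).+2 by lia.
  have := odd_half_twist4 n.+1; rewrite E !addn2 addn1.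
  exact: torus_genus4.
- exact: torus_genus5.
- exact: torus_genus6.
Qed.
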